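(* Consider the system $\dot y(t)=g(y(t))+A(\alpha_\star)\epsilon(t)$, $t\in[0,T]$, with state $y(t)\in\mathbb{R}^N$, and assume: the initial state is $y(0)=0$; $g$ is of class $C^1$, is Lipschitz continuous with Lipschitz constant $L$, and satisfies $g(0)=0$; the approximation of $\alpha_\star$ is $\alpha_\circ=0$; and the observer matrix is the identity, $C=I\in\mathbb{R}^{N\times N}$. Let $k\in\{1,\dots,K-1\}$ and let $\beta^k\in\mathcal{K}_k\subset\mathbb{R}^k$ be the solution of the fitting step problem of the GR algorithm (or let $k=0$ and $\beta^0=0$). Then the set of controls $\epsilon\in E_{ad}$ that satisfy both $$\|Cy(A(\alpha_\circ)+A^{(k)}(\beta^k),\epsilon;T)-Cy(A(\alpha_\circ)+A_{k+1},\epsilon;T)\|_2^2>0$$ and $$\|C\delta y_\circ(A^{(k)}(\beta^k),\epsilon;T)-C\delta y_\circ(A_{k+1},\epsilon;T)\|_2^2>0$$ is nonempty.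
   Context: $N,M,K$ are positive integers and $T>0$. The admissible set $E_{ad}\subset L^2(0,T;\mathbb{R}^M)$ is nonempty, weakly compact, and contains $\epsilon\equiv0$ as an interior point. $\mathcal{A}=\{A_1,\dots,A_K\}\subset\mathbb{R}^{N\times M}$ is a set of linearly independent matrices; $A(\alpha):=\sum_{j=1}^K\alpha_jA_j$ for $\alpha\in\mathbb{R}^K$; $A^{(k)}(\beta):=\sum_{j=1}^k\beta_jA_j$ for $\beta\in\mathbb{R}^k$ ($A^{(0)}=0$). $y(A,\epsilon;t)$ denotes the solution at time $t$ of $\dot y=g(y)+A\epsilon$, $y(0)=0$. $\delta y_\circ(\widetilde A,\epsilon;t)$ denotes the solution at time $t$ of the linearized equation around $\alpha_\circ=0$, $$\dot{\delta y}_\circ(t)=g'(y_\circ(t))\delta y_\circ(t)+\widetilde A\epsilon(t),\ \delta y_\circ(0)=0,\qquad \dot y_\circ(t)=g(y_\circ(t)),\ y_\circ(0)=0 .$$ GR algorithm (nonlinear greedy reconstruction), with input $\mathcal{A}$, $A(\alpha_\circ)$ and compact sets $\mathcal{K}_j\subset\mathbb{R}^j$, $j=1,\dots,K-1$: (1) Compute $\epsilon^1$ solving $\max_{\epsilon\in E_{ad}}\|Cy(A(\alpha_\circ),\epsilon;T)-Cy(A(\alpha_\circ)+A_1,\epsilon;T)\|_2^2$. (2) For $k=1,\dots,K-1$: (fitting step) find $\beta^k$ solving $\min_{\beta\in\mathcal{K}_k}\sum_{m=1}^k\|Cy(A(\alpha_\circ)+A^{(k)}(\beta),\epsilon^m;T)-Cy(A(\alpha_\circ)+A_{k+1},\epsilon^m;T)\|_2^2$;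 (splitting step) find $\epsilon^{k+1}$ solving $\max_{\epsilon\in E_{ad}}\|Cy(A(\alpha_\circ)+A^{(k)}(\beta^k),\epsilon;T)-Cy(A(\alpha_\circ)+A_{k+1},\epsilon;T)\|_2^2$. *)

(* Defs.v *)
From HB Require Import structures.
From mathcomp Require Import all_boot all_order all_algebra.
From mathcomp Require Import all_classical all_reals all_analysis.

Set Implicit Arguments.
Unset Strict Implicit.
Unset Printing Implicit Defensive.

Import Order.TTheory GRing.Theory Num.Theory.
Import numFieldNormedType.Exports.

Local Open Scope classical_set_scope.
Local Open Scope ring_scope.

(* The norm [`|x|] of the library on column vectors is the maximum norm, hence
   a separate definition of the Euclidean one. *)
Definition norm2 {R : realType} {n : nat} (x : 'cV[R]_n) : R :=
  Num.sqrt (\sum_(i < n) x i 0 ^+ 2).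

Definition jac {R : realType} {n : nat} (g : 'cV[R]_n -> 'cV[R]_n)
    (x : 'cV[R]_n) : 'M[R]_n :=
  \matrix_(i, j) ('d g x (delta_mx j 0 : 'cV[R]_n)) i 0.

Definition class_C1 {R : realType} {n : nat} (g : 'cV[R]_n -> 'cV[R]_n) :=
  (forall x, differentiable g x) /\ continuous (jac g).

Definition lipschitz2 {R : realType} {n : nat} (L : R)
    (g : 'cV[R]_n -> 'cV[R]_n) :=
  forall x y, norm2 (g x - g y) <= L * norm2 (x - y).

Definition is_maximizer {R : realType} {X : Type} (D : set X) (f : X -> R)
    (x : X) := D x /\ forall z, D z -> f z <= f x.

Definition is_minimizer {R : realType} {X : Type} (D : set X) (f : X -> R)
    (x : X) := D x /\ forall z, D z -> f x <= f z.

Section controls.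
Context {R : realType}.

Definition leb0T (T : R) :=
  mrestr (@lebesgue_measure R) (measurable_itv `[0, T]).

HB.instance Definition _ (T : R) := Measure.on (leb0T T).

(* L^2(0,T;R^M), as M-tuples of elements of L^2(0,T). The scalar [L^2] space of
   the library consists of classes of measurable functions on the whole line
   modulo almost everywhere equality for the measure, here the restriction of
   the Lebesgue measure to [0, T]; values outside [0, T] are irrelevant. *)
Definition control (T : R) (M : nat) : Type := 'I_M -> LspaceType2 (leb0T T).

HB.instance Definition _ T M := gen_eqMixin (control T M).
HB.instance Definition _ T M := gen_choiceMixin (control T M).

Definition ceval {T : R} {M : nat} (u : control T M) (t : R) : 'cV[R]_M :=
  \col_i (u i : R -> R) t.

Definition L2norm {T : R} {M : nat} (u : control T M) : R :=
  Num.sqrt (\int[leb0T T]_t (norm2 (ceval u t) ^+ 2)).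

(* Continuous linear functionals on L^2(0,T;R^M). The library puts no vector
   space structure on [LspaceType2], so linearity is expressed on
   representatives. *)
Definition L2dual (T : R) (M : nat) : Type :=
  {f : control T M -> R |
    (forall (a : R) (u v w : control T M),
       {ae leb0T T, forall t, ceval w t = a *: ceval u t + ceval v t} ->
       f w = a * f u + f v) /\
    (exists c : R, forall u, `|f u| <= c * L2norm u)}.

Definition L2eval {T : R} {M : nat} (u : control T M) :
  {ptws L2dual T M -> R} := fun f => sval f u.

Definition weakly_compact {T : R} {M : nat} (E : set (control T M)) :=
  compact (E : set (initial_topology (@L2eval T M))).

Definition zero_interior {T : R} {M : nat} (E : set (control T M)) :=
  exists2 r : R, 0 < r & forall u, L2norm u < r -> E u.

End controls.

Section ode.
Context {R : realType} {N : nat}.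

(* Solution on [0, T], in the sense of Caratheodory, of [x' = F t x] with
   [x(0) = 0]. *)
Definition is_solution (T : R) (F : R -> 'cV[R]_N -> 'cV[R]_N)
    (x : R -> 'cV[R]_N) :=
  {within `[0, T], continuous x} /\
  forall t, t \in `[0, T] -> forall i,
    (@lebesgue_measure R).-integrable `[0, t] (fun s => (F s (x s) i 0)%:E) /\
    x t i 0 = \int[@lebesgue_measure R]_(s in `[0, t]) (F s (x s) i 0).

(* Existence holds, and uniqueness on [0, T], for the Lipschitz right-hand
   sides considered here; only the values on [0, T] are meaningful. *)
Definition solution (T : R) (F : R -> 'cV[R]_N -> 'cV[R]_N) : R -> 'cV[R]_N :=
  get (is_solution T F).

Context (g : 'cV[R]_N -> 'cV[R]_N).

Definition state {T : R} {M : nat} (A : 'M[R]_(N, M)) (u : control T M) :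
    R -> 'cV[R]_N :=
  solution T (fun t y => g y + A *m ceval u t).

Definition state0 (T : R) : R -> 'cV[R]_N := solution T (fun=> g).

Definition lin_state {T : R} {M : nat} (A : 'M[R]_(N, M)) (u : control T M) :
    R -> 'cV[R]_N :=
  solution T (fun t z => jac g (state0 T t) *m z + A *m ceval u t).

End ode.

Section greedy.
Context {R : realType} {N M K : nat}.
Context (A : K.-tuple 'M[R]_(N, M)).

Definition Acomb (alpha : 'cV[R]_K) : 'M[R]_(N, M) :=
  \sum_(j < K) alpha j 0 *: tnth A j.

(* Indices start from 0: for [k : 'I_K], [tnth A k] is the matrix A_{k+1}. *)
Definition Apart (k : 'I_K) (beta : 'cV[R]_k) : 'M[R]_(N, M) :=
  \sum_(j < k) beta j 0 *: tnth A (widen_ord (ltnW (ltn_ord k)) j).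

Definition state_gap {P : nat} (C : 'M[R]_(P, N)) (g : 'cV[R]_N -> 'cV[R]_N)
    {T : R} (B1 B2 : 'M[R]_(N, M)) (u : control T M) : R :=
  norm2 (C *m state g B1 u T - C *m state g B2 u T) ^+ 2.

Definition lin_state_gap {P : nat} (C : 'M[R]_(P, N))
    (g : 'cV[R]_N -> 'cV[R]_N) {T : R} (B1 B2 : 'M[R]_(N, M))
    (u : control T M) : R :=
  norm2 (C *m lin_state g B1 u T - C *m lin_state g B2 u T) ^+ 2.

(* The iterates of the greedy reconstruction algorithm, from the initialization
   up to and including the fitting step [k]: [eps m] is the control eps^{m+1},
   so that eps^1, ..., eps^j are the [eps m] with [m < j]; [beta j], for
   [0 < j], is the vector beta^j in R^j. The three conjuncts are the
   initialization, the fitting steps 1, ..., k and the splitting steps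
   1, ..., k-1 (step [j] returning eps^{j+1}, that is [eps j]). *)
Definition GR_until_fitting {P : nat} (C : 'M[R]_(P, N))
    (g : 'cV[R]_N -> 'cV[R]_N) {T : R} (Ead : set (control T M))
    (alpha0 : 'cV[R]_K) (Kset : forall j : 'I_K, set 'cV[R]_j)
    (eps : 'I_K -> control T M) (beta : forall j : 'I_K, 'cV[R]_j)
    (k : 'I_K) : Prop :=
  [/\ forall i : 'I_K, i = 0%N :> nat ->
        is_maximizer Ead
          (state_gap C g (Acomb alpha0) (Acomb alpha0 + tnth A i)) (eps i),
      forall j : 'I_K, (0 < j <= k)%N ->
        is_minimizer (Kset j)
          (fun b => \sum_(m < K | (m < j)%N)
             state_gap C g (Acomb alpha0 + Apart b)
               (Acomb alpha0 + tnth A j) (eps m))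
          (beta j)
    & forall j : 'I_K, (0 < j < k)%N ->
        is_maximizer Ead
          (state_gap C g (Acomb alpha0 + Apart (beta j))
             (Acomb alpha0 + tnth A j)) (eps j)].

End greedy.

(* Main.v *)
(** On [0, T - d] the control vanishes, on ]T - d, T] it is a constant v with
    w := (B1 - B2) v <> 0, where B1 is the fitted matrix and B2 = A_{k+1}; such
    a v exists by linear independence. If f is the common drift (g, or its
    derivative at 0, since y_o = 0), then the difference D of the two states is
    0 up to T - d, and D(T) - d w is the integral of f(y1) - f(y2) over
    [T - d, T]. For L the Lipschitz constant of f and L d <= 1/4, the maximum m
    of |D| satisfies m <= L d m + d |w|, hence |D(T) - d w| <= d |w| / 3 and
    D(T) <> 0. The same d serves both drifts, and the L^2 norm of the control
    is |v| sqrt d, so that it is admissible for d small. States are selected by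
    a choice operator, so solutions must be shown to exist: Picard iteration on
    the short interval [T - d, T]. *)
Require Import Defs.
From mathcomp Require Import all_boot all_order all_algebra.
From mathcomp Require Import all_classical all_reals all_analysis.
From mathcomp Require Import measurable_realfun ring lra.

Import Order.TTheory GRing.Theory Num.Theory.
Import numFieldNormedType.Exports.

Local Open Scope classical_set_scope.
Local Open Scope ring_scope.

(** * Maximum and Euclidean norms of column vectors; Lipschitz maps *)

Lemma cV_norm_le {R : realType} {n : nat} (x : 'cV[R]_n) (e : R) : 0 <= e ->
  (forall i, `|x i 0| <= e) -> `|x| <= e.
Proof.
move=> e0 h; rewrite [leLHS]/Num.norm/= mx_normrE.
by apply/bigmax_leP; split => // -[i j] _ /=; rewrite ord1.
Qed.

Lemma cV_entry_le {R : realType} {n : nat} (x : 'cV[R]_n) i : `|x i 0| <= `|x|.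
Proof.
rewrite [leRHS]/Num.norm/= mx_normrE.
by apply/bigmax_geP; right; exists (i, 0).
Qed.

Lemma norm_le_norm2 {R : realType} {n : nat} (x : 'cV[R]_n) : `|x| <= norm2 x.
Proof.
apply: cV_norm_le => [|i]; first exact: sqrtr_ge0.
rewrite /norm2 -sqrtr_sqr ler_wsqrtr// (bigD1 i)//=.
by rewrite lerDl sumr_ge0 // => ? _; exact: sqr_ge0.
Qed.

(** The constant [n] is cruder than its square root: [n] squares, each at most |x|^2, sum to at most
    n^2 |x|^2. *)
Lemma norm2_le_norm {R : realType} {n : nat} (x : 'cV[R]_n) :
  norm2 x <= n%:R * `|x|.
Proof.
rewrite -(ger0_norm (mulr_ge0 (ler0n _ n) (normr_ge0 x))) -sqrtr_sqr.
rewrite ler_wsqrtr//; apply: (@le_trans _ _ (\sum_(i < n) `|x| ^+ 2)).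
  apply: ler_sum => i _; rewrite -real_normK ?num_real// lerXn2r ?nnegrE//.
  exact: cV_entry_le.
rewrite sumr_const card_ord -[leLHS]mulr_natl exprMn ler_wpM2r ?sqr_ge0//.
by rewrite -natrX ler_nat -mulnn; case: (n) => // k; rewrite leq_pmulr.
Qed.

Lemma norm2_gt0 {R : realType} {n : nat} (x : 'cV[R]_n) :
  x != 0 -> 0 < norm2 x.
Proof. by move=> x0; rewrite (lt_le_trans _ (norm_le_norm2 x))// normr_gt0. Qed.

Lemma norm_mulmx_le {R : realType} {n : nat} (J : 'M[R]_n) (x : 'cV[R]_n) :
  `|J *m x| <= (\sum_i \sum_j `|J i j|) * `|x|.
Proof.
have J0 i : 0 <= \sum_j `|J i j| by rewrite sumr_ge0.
apply: cV_norm_le => [|i]; first by rewrite mulr_ge0// sumr_ge0.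
rewrite mxE; apply: (@le_trans _ _ ((\sum_j `|J i j|) * `|x|)).
  rewrite (le_trans (ler_norm_sum _ _ _))// mulr_suml ler_sum// => j _.
  by rewrite normrM ler_wpM2l//; exact: cV_entry_le.
by rewrite ler_wpM2r// [leRHS](bigD1 i)//= lerDl sumr_ge0.
Qed.

(** Lipschitz continuity for the maximum norm, in which all estimates on solutions are made because
    it reduces them to single entries. *)
Definition lip {R : realType} {n : nat} (L : R) (f : 'cV[R]_n -> 'cV[R]_n) :=
  forall x y, `|f x - f y| <= L * `|x - y|.

(** Changing norms costs the factor [n]; the absolute value makes the constant nonnegative, whatever
    the sign of [L]. *)
Lemma lip_lipschitz2 {R : realType} {n : nat} (L : R)
  (f : 'cV[R]_n -> 'cV[R]_n) : lipschitz2 L f -> lip (`|L| * n%:R) f.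
Proof.
move=> h x y; apply: le_trans (norm_le_norm2 _) _.
apply: le_trans (h _ _) _; rewrite -mulrA.
apply: (@le_trans _ _ (`|L| * norm2 (x - y))).
  by rewrite ler_wpM2r ?sqrtr_ge0// ler_norm.
by rewrite ler_wpM2l//; exact: norm2_le_norm.
Qed.

Lemma lip_mulmx {R : realType} {n : nat} (J : 'M[R]_n) :
  lip (\sum_i \sum_j `|J i j|) (mulmx J : 'cV_n -> _).
Proof. by move=> x y; rewrite -mulmxBr; exact: norm_mulmx_le. Qed.

Lemma lip_le {R : realType} {n : nat} (L L' : R) (f : 'cV[R]_n -> 'cV[R]_n) :
  L <= L' -> lip L f -> lip L' f.
Proof.
by move=> LL' h x y; apply: le_trans (h x y) _; rewrite ler_wpM2r.
Qed.

(** * Integrals over half-open intervals *)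

Local Notation mu := lebesgue_measure.

Lemma integrable_cst_oc {R : realType} (a b D : R) :
  mu.-integrable `]a, b] (EFin \o (fun=> D)).
Proof.
apply: (@integrableS _ _ R mu `[a, b]) => //.
  by apply: subset_itvr; rewrite bnd_simp.
apply: continuous_compact_integrable; first exact: segment_compact.
by apply: continuous_subspaceT => ?; exact: cvg_cst.
Qed.

Lemma Rintegral_cst_oc {R : realType} (a b D : R) : a <= b ->
  \int[mu]_(s in `]a, b]) D = D * (b - a).
Proof.
move=> ab; rewrite Rintegral_cst//; congr (_ * _).
rewrite [X in fine X]lebesgue_measure_itv/= lte_fin.
by move: ab; rewrite le_eqVlt => /predU1P[->|->//]; rewrite ltxx subrr.
Qed.

Lemma norm_Rintegral_oc_le {R : realType} (h : R -> R) (a b D : R) : a <= b ->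
  mu.-integrable `]a, b] (EFin \o h) ->
  (forall s, s \in `]a, b] -> `|h s| <= D) ->
  `|\int[mu]_(s in `]a, b]) h s| <= D * (b - a).
Proof.
move=> ab ih hD; apply: le_trans; first exact: le_normr_Rintegral.
rewrite -Rintegral_cst_oc//; apply: le_Rintegral => //.
- exact: integrable_norm.
- exact: integrable_cst_oc.
Qed.

Lemma Rintegral_cc_oc {R : realType} (h : R -> R) (a b c : R) :
  a <= c -> c <= b ->
  mu.-integrable `[a, b] (EFin \o h) ->
  \int[mu]_(s in `[a, b]) h s - \int[mu]_(s in `[a, c]) h s =
  \int[mu]_(s in `]c, b]) h s.
Proof. by move=> ac cb ih; rewrite Rintegral_itvB// bnd_simp. Qed.

(** * Comparison of two Caratheodory solutions *)

Section solutions.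
Context {R : realType} {N : nat}.
Local Notation V := 'cV[R]_N.
Implicit Types (F : R -> V -> V) (x : R -> V) (T : R).

(** Subtracting the integral equations at [a] and [t] turns each entry into the integral of F1 - F2
    - w over ]a, t]. The vector [w] stands for a constant difference of forcings. *)
Lemma solution_increment T F1 F2 x1 x2 a t w D :
  is_solution T F1 x1 -> is_solution T F2 x2 -> 0 <= a -> a <= t -> t <= T ->
  0 <= D ->
  (forall s, s \in `]a, t] -> `|F1 s (x1 s) - F2 s (x2 s) - w| <= D) ->
  `|(x1 t - x2 t) - (x1 a - x2 a) - (t - a) *: w| <= D * (t - a).
Proof.
move=> [_ s1] [_ s2] a0 at_ tT D0 h; apply: cV_norm_le => [|i].
  by rewrite mulr_ge0// subr_ge0.
have tI : t \in `[0, T] by rewrite in_itv/= tT (le_trans a0).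
have aI : a \in `[0, T] by rewrite in_itv/= a0 (le_trans at_).
have [[i1t e1t] [i1a e1a]] := (s1 t tI i, s1 a aI i).
have [[i2t e2t] [i2a e2a]] := (s2 t tI i, s2 a aI i).
rewrite !mxE e1t e1a e2t e2a.
have sub : `]a, t] `<=` `[0, t] by apply: subset_itvr; rewrite bnd_simp.
have j1 : mu.-integrable `]a, t] (EFin \o (fun s => F1 s (x1 s) i 0)).
  exact: integrableS i1t.
have j2 : mu.-integrable `]a, t] (EFin \o (fun s => F2 s (x2 s) i 0)).
  exact: integrableS i2t.
have jw : mu.-integrable `]a, t] (EFin \o (fun s : R => w i 0)).
  exact: integrable_cst_oc.
have j12 : mu.-integrable `]a, t]
    (EFin \o (fun s => F1 s (x1 s) i 0 - F2 s (x2 s) i 0)).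
  by have := integrableB _ j1 j2; apply.
have -> : forall p q r s u : R, p - q - (r - s) - u = (p - r) - (q - s) - u.
  by move=> *; ring.
rewrite (Rintegral_cc_oc _ _ _ _ a0 at_ i1t).
rewrite (Rintegral_cc_oc _ _ _ _ a0 at_ i2t).
rewrite -(RintegralB _ j1 j2)//.
have -> : (t - a) * w i 0 = \int[mu]_(s in `]a, t]) (w i 0).
  by rewrite Rintegral_cst_oc// mulrC.
rewrite -(RintegralB _ j12 jw)//; apply: norm_Rintegral_oc_le => //.
  by have := integrableB _ j12 jw; apply.
move=> s sI; apply: le_trans (h s sI); apply: le_trans (cV_entry_le _ i).
by rewrite !mxE.
Qed.

(** A substitute for Gronwall's inequality: advance by steps of length [e] with L e <= 1/2. If the
    solutions agree at the start of a step, the maximum m of their distance over it satisfies m <= m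
    / 2. The two fields may differ, so the Lipschitz bound is stated along the solutions. *)
Lemma solution_unique T F1 F2 x1 x2 a L :
  is_solution T F1 x1 -> is_solution T F2 x2 -> 0 <= a -> a <= T -> 0 <= L ->
  (forall s, s \in `]0, a] ->
    `|F1 s (x1 s) - F2 s (x2 s)| <= L * `|x1 s - x2 s|) ->
  forall t, t \in `[0, a] -> x1 t = x2 t.
Proof.
move=> s1 s2 a0 aT L0 h.
(* Adding 1 to [L] keeps the step length meaningful for L = 0. *)
pose e := (2 * (L + 1))^-1.
have L1 : 0 < L + 1 by rewrite ltr_wpDl.
have e0 : 0 < e by rewrite invr_gt0 mulr_gt0.
have Le : L * e <= 2^-1.
  by rewrite /e invfM mulrCA ler_piMr ?invr_ge0// ler_pdivrMr// mul1r lerDl.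
have x0 F x : is_solution T F x -> x 0 = 0.
  move=> [_ s]; apply/colP => i.
  have [|_ ->] := s 0 _ i; first by rewrite in_itv/= lexx (le_trans a0).
  by rewrite set_itv1 Rintegral_set1 mxE.
suff H n t : t \in `[0, a] -> t <= n%:R * e -> x1 t = x2 t.
  move=> t ta; apply: (H (Num.truncn (t / e)).+1) => //.
  rewrite -ler_pdivrMr//; exact/ltW/truncnS_gt.
elim: n t => [|n IH] t.
  rewrite mul0r in_itv/= => /andP[t0 _] t0'.
  have -> : t = 0 by apply/eqP; rewrite eq_le t0 t0'.
  by rewrite (x0 _ _ s1) (x0 _ _ s2).
rewrite in_itv/= => /andP[t0 ta] tn.
have [tn'|nt] := leP t (n%:R * e); first by
  apply: IH => //; rewrite in_itv/= t0.
set p := n%:R * e in IH nt.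
have p0 : 0 <= p by rewrite mulr_ge0// ltW.
have xp : x1 p = x2 p.
  by apply: IH => //; rewrite in_itv/= p0 ltW// (lt_le_trans nt).
have cd : {within `[p, t], continuous (fun s => `|x1 s - x2 s| : R)}.
  have sub : `[p, t] `<=` `[0, T].
    by apply: subset_itv; rewrite bnd_simp// (le_trans ta).
  move=> s; apply: cvg_norm; apply: cvgB.
    exact: (continuous_subspaceW sub s1.1).
  exact: (continuous_subspaceW sub s2.1).
have [s sI smax] := EVT_max (ltW nt) cd.
move: (sI); rewrite in_itv/= => /andP[ps st].
have : `|x1 s - x2 s| <= L * `|x1 s - x2 s| * (s - p).
  have := @solution_increment T F1 F2 x1 x2 p s 0 (L * `|x1 s - x2 s|)
    s1 s2 p0 ps.
  rewrite xp subrr subr0 scaler0 subr0; apply.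
  - by rewrite (le_trans st)// (le_trans ta).
  - by rewrite mulr_ge0.
  - move=> r; rewrite in_itv/= => /andP[pr rs]; rewrite subr0.
    apply: le_trans (h r _) _.
      by rewrite in_itv/= (le_lt_trans p0 pr) (le_trans rs)// (le_trans st).
    by rewrite ler_wpM2l//; apply: smax; rewrite in_itv/= ltW//= (le_trans rs).
have sp : s - p <= e.
  rewrite lerBlDr; apply: le_trans st _; apply: le_trans tn _.
  by rewrite /p -addn1 natrD mulrDl mul1r addrC.
have m0 := normr_ge0 (x1 s - x2 s).
move=> hm; have /eqP : `|x1 s - x2 s| = 0.
  apply/eqP; rewrite eq_le m0 andbT.
  have : `|x1 s - x2 s| <= `|x1 s - x2 s| * (L * e).
    by apply: le_trans hm _; rewrite mulrAC mulrC ler_wpM2l// ler_wpM2l.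
  have := ler_wpM2l m0 Le; lra.
move=> /eqP ms; apply/eqP; rewrite -subr_eq0 -normr_le0 -ms.
by apply: smax; rewrite in_itv/= ltW//= lexx.
Qed.

Lemma solution_gap T F1 F2 x1 x2 c w L :
  is_solution T F1 x1 -> is_solution T F2 x2 -> 0 <= c -> c < T -> 0 <= L ->
  L * (T - c) <= 4^-1 -> w != 0 ->
  (forall s, s \in `]0, c] ->
    `|F1 s (x1 s) - F2 s (x2 s)| <= L * `|x1 s - x2 s|) ->
  (forall s, s \in `]c, T] ->
    `|F1 s (x1 s) - F2 s (x2 s) - w| <= L * `|x1 s - x2 s|) ->
  x1 T != x2 T.
Proof.
move=> s1 s2 c0 cT L0 Lc w0 h0 h1.
have xc : x1 c = x2 c.
  apply: (@solution_unique T F1 F2 x1 x2 c L) => //; first exact: ltW.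
  by rewrite in_itv/= c0 lexx.
have cd : {within `[c, T], continuous (fun s => `|x1 s - x2 s| : R)}.
  have sub : `[c, T] `<=` `[0, T] by apply: subset_itvr; rewrite bnd_simp.
  move=> s; apply: cvg_norm; apply: cvgB.
    exact: (continuous_subspaceW sub s1.1).
  exact: (continuous_subspaceW sub s2.1).
have [s sI smax] := EVT_max (ltW cT) cd.
set m := `|x1 s - x2 s| in smax.
have m0 : 0 <= m by exact: normr_ge0.
(* The difference is 0 at [c] and then follows (t - c) w, up to an error proportional to its own
   maximum [m]. *)
have key t : t \in `[c, T] -> `|x1 t - x2 t - (t - c) *: w| <= L * m * (t - c).
  rewrite in_itv/= => /andP[ct tT].
  have := @solution_increment T F1 F2 x1 x2 c t w (L * m) s1 s2 c0 ct tT.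
  rewrite xc subrr subr0; apply; first by rewrite mulr_ge0.
  move=> r; rewrite in_itv/= => /andP[cr rt].
  apply: le_trans (h1 r _) _; first by rewrite in_itv/= cr (le_trans rt).
  by rewrite ler_wpM2l//; apply: smax; rewrite in_itv/= ltW//= (le_trans rt).
have Lm t : t \in `[c, T] -> L * m * (t - c) <= m / 4.
  rewrite in_itv/= => /andP[ct tT].
  apply: (@le_trans _ _ (L * m * (T - c))).
    by rewrite ler_wpM2l ?mulr_ge0// lerB.
  by rewrite mulrAC mulrC ler_wpM2l.
have TI : T \in `[c, T] by rewrite in_itv/= ltW//= lexx.
have w1 : 0 < `|w| by rewrite normr_gt0.
have d0 : 0 < T - c by rewrite subr_gt0.
have wd : 0 < (T - c) * `|w| by rewrite mulr_gt0.
have mle : m <= m / 4 + (T - c) * `|w|.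
  have := le_trans (key s sI) (Lm s sI).
  move: sI; rewrite in_itv/= => /andP[cs sT] k.
  rewrite [leLHS](_ : _ =
      `|x1 s - x2 s - (s - c) *: w + (s - c) *: w|); last first.
    by rewrite subrK.
  apply: le_trans (ler_normD _ _) _; rewrite lerD// normrZ.
  rewrite ger0_norm ?subr_ge0//.
  by rewrite ler_wpM2r// lerB.
(* If the solutions met at [T], [key] would give (T - c) |w| <= m / 4, whereas [mle] gives m / 4 <=
   (T - c) |w| / 3. *)
apply/negP => /eqP xT.
have := le_trans (key T TI) (Lm T TI).
rewrite xT subrr sub0r normrN normrZ gtr0_norm//.
lra.
Qed.

End solutions.

(** * Existence by Picard iteration *)

Lemma halving_limit {R : realType} (u : R^nat) (B : R) :
  (forall n, `|u n.+1 - u n| <= B * 2^-1 ^+ n) ->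
  forall n, `|limn u - u n| <= 2 * B * 2^-1 ^+ n.
Proof.
move=> h.
have B0 : 0 <= B by have := le_trans (normr_ge0 _) (h 0%N); rewrite expr0 mulr1.
(* [limn] is a true limit only for a convergent sequence; here the increments are dominated by a
   geometric series. *)
have cu : cvgn u.
  have -> : u = (fun n => u 0%N + series (telescope u) n).
    by apply/funext => n; exact: eq_sum_telescope.
  apply: is_cvgD; first exact: is_cvg_cst.
  apply: normed_cvg; apply: (series_le_cvg _ _ h) => [n|n|].
  - exact: normr_ge0.
  - by rewrite mulr_ge0// exprn_ge0.
  - apply: is_cvg_geometric_series.
    by rewrite ger0_norm// invf_lt1// ltr1n.
(* The bound is the exact geometric sum from [n] to n + m, a form that passes through the induction
   on [m]. *)
have key n m : `|u (n + m)%N - u n| <= 2 * B * (2^-1 ^+ n - 2^-1 ^+ (n + m)).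
  elim: m => [|m IH]; first by rewrite addn0 !subrr normr0 mulr0.
  rewrite addnS -[X in `|X|](subrKA (u (n + m)%N)).
  apply: le_trans (ler_normD _ _) _.
  apply: le_trans (lerD (h _) IH) _.
  by rewrite exprS; lra.
move=> n; apply/ler_addgt0Pr => e e0.
have /cvgrPdist_le/(_ e e0) [k _ hk] := cu.
have := hk (n + k)%N (leq_addl _ _); rewrite /= => hl.
rewrite -(subrKA (u (n + k)%N)); apply: le_trans (ler_normD _ _) _.
rewrite addrC lerD//; apply: le_trans (key n k) _.
rewrite ler_wpM2l ?mulr_ge0// lerBlDr lerDl exprn_ge0//.
Qed.

Lemma continuous_lip {R : realType} {V W : normedModType R} (h : V -> W)
  (K : R) :
  (forall s t, `|h t - h s| <= K * `|t - s|) -> continuous h.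
Proof.
move=> hK t; apply/cvgrPdist_le => e e0.
have K1 : 0 < `|K| + 1 by rewrite ltr_wpDl.
near=> s; apply: le_trans (hK _ _) _.
apply: (@le_trans _ _ ((`|K| + 1) * `|t - s|)).
  by rewrite ler_wpM2r// (le_trans (ler_norm _))// lerDl.
rewrite -ler_pdivlMl// mulrC; near: s.
apply: cvgr_dist_le; first exact: cvg_id.
by rewrite divr_gt0.
Unshelve. all: by end_near. Qed.

Lemma ler_dist_half {R : realType} {V : normedZmodType R} (u v w : V) (e : R) :
  `|u - v| <= e / 2 -> `|v - w| <= e / 2 -> `|u - w| <= e.
Proof. by have := ler_distD v u w; lra. Qed.

Section picard.
Context {R : realType} {N : nat}.
Local Notation V := 'cV[R]_N.
(** The problem is x' = f(x) + b on [c, T] with x(c) = 0; the bound on L (T - c) makes the Picard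
    map halve distances. *)
Variables (f : V -> V) (L : R) (b : V) (c T : R).
Hypotheses (L0 : 0 <= L) (fL : lip L f) (f0 : f 0 = 0) (cT : c <= T)
  (Lc : L * (T - c) <= 2^-1).

(* Integrating up to [clamp t] makes the iterates vanish before [c] and stay
   constant after [T], hence Lipschitz on the whole line. *)
Let clamp (t : R) := Num.max c (Num.min t T).

Let clamp_ge t : c <= clamp t. Proof. by rewrite le_max lexx. Qed.

Let clamp_le t : clamp t <= T.
Proof. by rewrite ge_max cT ge_min lexx orbT. Qed.

Let clamp_incr s t : s <= t -> 0 <= clamp t - clamp s <= t - s.
Proof.
by rewrite /clamp => st; case: (leP s T) => ?; case: (leP t T) => ?;
  rewrite /Num.max; do ?[case: ifPn; rewrite -?leNgt => ?]; lra.
Qed.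

Let rhs (x : R -> V) i s := (f (x s) + b) i 0.

Let picard (x : R -> V) (t : R) : V :=
  \col_i \int[mu]_(s in `]c, clamp t]) rhs x i s.

(** This invariant of the iteration makes the integrands continuous, hence integrable on bounded
    intervals. *)
Let lipfun (K : R) (x : R -> V) := forall s t, `|x t - x s| <= K * `|t - s|.

Let rhs_lip K x i : lipfun K x ->
  forall s t, `|rhs x i t - rhs x i s| <= L * K * `|t - s|.
Proof.
move=> hx s t; have := cV_entry_le (f (x t) - f (x s)) i.
rewrite /rhs !mxE opprD addrACA subrr addr0 => h; apply: le_trans h _.
by apply: le_trans (fL _ _) _; rewrite -mulrA ler_wpM2l.
Qed.

Let rhs_integrable K x i a d : lipfun K x ->
  mu.-integrable `]a, d] (EFin \o rhs x i).
Proof.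
move=> hx; apply: (@integrableS _ _ R mu `[a, d]) => //.
  by apply: subset_itvr; rewrite bnd_simp.
apply: continuous_compact_integrable; first exact: segment_compact.
apply: continuous_subspaceT; apply: (@continuous_lip _ _ _ _ (L * K)) => s t.
exact: rhs_lip.
Qed.

(** The radius [B] is preserved by the Picard map: |x| <= B gives |picard x| <= (L B + |b|) (T - c)
    <= B / 2 + B / 2. The factor [D] bounds the right-hand side on that ball, so it is a Lipschitz
    constant of every iterate. *)
Let B : R := 2 * (T - c) * `|b|.
Let D : R := L * B + `|b|.

Let B0 : 0 <= B. Proof. by rewrite !mulr_ge0// subr_ge0. Qed.
Let D0 : 0 <= D. Proof. by rewrite addr_ge0// mulr_ge0. Qed.

Let rhs_bound x i s : `|x s| <= B -> `|rhs x i s| <= D.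
Proof.
move=> hx; rewrite /rhs; apply: le_trans (cV_entry_le _ _) _.
apply: le_trans (ler_normD _ _) _; rewrite lerD//.
have := fL (x s) 0; rewrite f0 !subr0 => /le_trans; apply.
by rewrite ler_wpM2l.
Qed.

Let picard_bound K x : lipfun K x -> (forall s, `|x s| <= B) ->
  forall t, `|picard x t| <= B.
Proof.
move=> hx xB t; apply: cV_norm_le => // i; rewrite mxE.
apply: (@le_trans _ _ (D * (clamp t - c))).
  apply: norm_Rintegral_oc_le => // [|s _]; last exact: rhs_bound.
  exact: rhs_integrable _ _ _ _ _ hx.
apply: (@le_trans _ _ (D * (T - c))); first by rewrite ler_wpM2l// lerB.
have Bh : `|b| * (T - c) = B / 2 by rewrite /B; lra.
by have := ler_wpM2l B0 Lc; rewrite /D mulrDl Bh; lra.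
Qed.

Let picard_lip K x : lipfun K x -> (forall s, `|x s| <= B) ->
  lipfun D (picard x).
Proof.
move=> hx xB; suff H s t : s <= t -> `|picard x t - picard x s| <= D * (t - s).
  move=> s t; have [st|/ltW ts] := leP s t.
    by rewrite (ger0_norm (_ : 0 <= t - s)) ?subr_ge0// H.
  by rewrite distrC (distrC t) (ger0_norm (_ : 0 <= s - t)) ?subr_ge0// H.
move=> st; have /andP[c1 c2] := clamp_incr _ _ st.
apply: cV_norm_le => [|i]; first by rewrite mulr_ge0// subr_ge0.
rewrite !mxE Rintegral_itvB; last 3 first.
- exact: rhs_integrable _ _ _ _ _ hx.
- by rewrite bnd_simp.
- by rewrite bnd_simp -subr_ge0.
apply: (@le_trans _ _ (D * (clamp t - clamp s))); last by rewrite ler_wpM2l.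
apply: norm_Rintegral_oc_le => // [||r _]; last exact: rhs_bound.
- by rewrite -subr_ge0.
- exact: rhs_integrable _ _ _ _ _ hx.
Qed.

Let picard_contract K x y e : lipfun K x -> lipfun K y ->
  (forall s, `|x s - y s| <= e) ->
  forall t, `|picard x t - picard y t| <= e / 2.
Proof.
move=> hx hy xy t; have e0 : 0 <= e by exact: le_trans (xy 0).
apply: cV_norm_le => [|i]; first by rewrite divr_ge0.
have ix := rhs_integrable _ _ i c (clamp t) hx.
have iy := rhs_integrable _ _ i c (clamp t) hy.
rewrite !mxE -(RintegralB _ ix iy)//.
apply: (@le_trans _ _ (L * e * (clamp t - c))).
  apply: norm_Rintegral_oc_le => // [|s _].
    by have := integrableB _ ix iy; apply.
  rewrite /rhs !mxE opprD addrACA subrr addr0.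
  have := cV_entry_le (f (x s) - f (y s)) i; rewrite !mxE => /le_trans; apply.
  by apply: le_trans (fL _ _) _; rewrite ler_wpM2l.
apply: (@le_trans _ _ (L * e * (T - c))).
  by rewrite ler_wpM2l ?mulr_ge0// lerB.
by rewrite mulrAC mulrC ler_wpM2l.
Qed.

Let xs n := iter n picard (fun=> 0).

Let xsP n : lipfun D (xs n) /\ forall t, `|xs n t| <= B.
Proof.
elim: n => [|n [IH1 IH2]]; split => [s t|t] /=.
- by rewrite subr0 normr0 mulr_ge0.
- by rewrite normr0.
- exact: picard_lip _ _ IH1 IH2 _ _.
- exact: picard_bound _ _ IH1 IH2 _.
Qed.

Let xs_step n t : `|xs n.+1 t - xs n t| <= B * 2^-1 ^+ n.
Proof.
elim: n t => [|n IH] t.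
  by rewrite expr0 mulr1 [xs 0 t]/= subr0; apply: (xsP 1%N).2.
rewrite exprSr mulrA; apply: picard_contract _ _ _ _ _ _ IH _; exact: (xsP _).1.
Qed.

(** Limits are taken entry by entry, so that only real sequences have to converge; [xs_cvg] makes
    the convergence uniform in [t]. *)
Let x t : V := \col_i limn (fun n => xs n t i 0).

Let xs_cvg n t : `|x t - xs n t| <= 2 * B * 2^-1 ^+ n.
Proof.
apply: cV_norm_le => [|i]; first by rewrite mulr_ge0 ?exprn_ge0// mulr_ge0.
rewrite !mxE; apply: halving_limit => m; apply: le_trans (xs_step m t).
by have := cV_entry_le (xs m.+1 t - xs m t) i; rewrite !mxE.
Qed.

Let xs_near e : 0 < e ->
  exists n, forall m t, (n <= m)%N -> `|x t - xs m t| <= e.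
Proof.
move=> e0; have : (fun n => 2 * B * 2^-1 ^+ n) @ \oo --> (0 : R).
  by apply: cvg_geometric; rewrite ger0_norm// invf_lt1// ltr1n.
move=> /cvgrPdist_le/(_ e e0)[n _ hn]; exists n => m t nm.
apply: le_trans (xs_cvg m t) _; have := hn m nm.
by rewrite /= sub0r normrN; apply: le_trans; exact: ler_norm.
Qed.

(** A uniform limit of functions with a common Lipschitz constant inherits it. *)
Let x_lip : lipfun D x.
Proof.
move=> s t; apply/ler_addgt0Pr => e e0.
have [n hn] := @xs_near (e / 2) (divr_gt0 e0 (ltr0n _ 2)).
have h1 := hn n t (leqnn _).
have h2 := hn n s (leqnn _); rewrite distrC in h2.
have h3 := (xsP n).1 s t.
have h4 := ler_distD (xs n t) (x t) (x s).
have h5 := ler_distD (xs n s) (xs n t) (x s).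
lra.
Qed.

(** The next iterate [picard (xs n)] is within e / 2 of [x], and by contraction within e / 4 of
    [picard x]. *)
Let x_fix t : x t = picard x t.
Proof.
apply/eqP; rewrite -subr_eq0 -normr_le0; apply/ler_addgt0Pr => e e0.
rewrite add0r; have [n hn] := @xs_near (e / 2) (divr_gt0 e0 (ltr0n _ 2)).
have h1 : `|x t - picard (xs n) t| <= e / 2 := hn n.+1 t (leqnSn n).
have h2 : `|picard (xs n) t - picard x t| <= (e / 2) / 2.
  apply: (picard_contract _ _ _ _ (xsP n).1 x_lip) => s.
  by rewrite distrC hn.
apply: ler_dist_half h1 _; apply: le_trans h2 _.
by rewrite ler_pdivrMr// ler_peMr ?ler1n// divr_ge0// ltW.
Qed.

(** With the forcing switched on at [c], the state rests at 0 until then because f 0 = 0, and is the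
    Picard fixed point afterwards. *)
Lemma solution_exists : 0 <= c ->
  exists y, is_solution T (fun s z => f z + (if c < s then b else 0)) y.
Proof.
move=> c0; exists x; have x0 t : t <= c -> x t = 0.
  move=> tc; rewrite x_fix; apply/colP => i; rewrite !mxE.
  have -> : clamp t = c.
    by rewrite /clamp; apply/max_idPl; rewrite ge_min tc.
  by rewrite set_itvoc0 Rintegral_set0.
split.
  exact: continuous_subspaceT (continuous_lip _ _ x_lip).
move=> t; rewrite in_itv/= => /andP[t0 tT] i.
(* For t <= c both sides are empty, so one identity covers the times before and after the switch. *)
have tc : `]c, clamp t]%classic = `[0, t]%classic `&` `]c, t]%classic.
  apply/seteqP; split => s /=; rewrite !in_itv/= le_max le_min.
    move=> /andP[cs /orP[|/andP[st _]]]; first by rewrite leNgt cs.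
    by rewrite st cs (le_trans c0 (ltW cs)).
  by move=> [/andP[_ st] /andP[-> _]]; rewrite st (le_trans st tT) orbT.
(* Up to [c] both sides vanish, since x = 0 there. *)
have E s : s \in `[0, t] ->
    (f (x s) + (if c < s then b else 0)) i 0 = (rhs x i \_ `]c, t]) s.
  rewrite in_itv/= => /andP[s0 st]; rewrite patchE mem_setE in_itv/= st andbT.
  by case: ltP => // sc; rewrite x0// f0 addr0 mxE.
have ic := rhs_integrable _ _ i c (clamp t) x_lip.
split.
  have ir : mu.-integrable `[0, t] ((EFin \o rhs x i) \_ `]c, t]).
    by apply/integrable_restrict => //; rewrite -tc.
  apply: (eq_integrable _ _ _ _ ir) => // s.
  by rewrite inE => sI; rewrite restrict_EFin /= E.
rewrite x_fix mxE tc Rintegral_mkcondr; apply: eq_Rintegral => s.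
by rewrite inE => /= sI; rewrite E.
Qed.

End picard.

(** * Null sets and measurability along solutions *)

Lemma ae_leb0T {R : realType} (T : R) (P Q : R -> Prop) :
  {ae leb0T T, forall s, P s} -> (forall s, s \in `[0, T] -> P s -> Q s) ->
  {ae leb0T T, forall s, Q s}.
Proof.
(* The complement of [0, T] joins the exceptional set at no cost, as the measure is restricted to
   [0, T]. *)
move=> [B [mB B0 hB]] PQ; exists (B `|` ~` `[0, T]); split.
- by apply: measurableU => //; exact: measurableC.
- rewrite -[LHS]/(mu ((B `|` ~` `[0, T]) `&` `[0, T])).
  by rewrite setIUl setICl setU0.
- move=> s /= nQ; apply: contrapT => /not_orP[nB /contrapT sI]; apply: nQ.
  by apply: PQ => //; apply: contrapT => nP; apply: nB; exact: hB.
Qed.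

Section caratheodory.
Context {R : realType} {N : nat}.
Local Notation V := 'cV[R]_N.

(** Integrals ignore null sets, so the representative of a control can be exchanged for a step
    function. Measurability of the new integrand is a separate hypothesis, as almost everywhere
    equality alone does not transfer it. *)
Lemma is_solution_ae (T : R) (F F' : R -> V -> V) (x : R -> V) :
  {ae leb0T T, forall s, F s = F' s} ->
  (forall i, measurable_fun `[0, T] (fun s => F' s (x s) i 0)) ->
  is_solution T F x -> is_solution T F' x.
Proof.
move=> [P [mP P0 hP]] mF' [cx hx]; split=> // t tI i.
have [iF ->] := hx t tI i.
have sub : `[0, t] `<=` `[0, T].
  move: tI; rewrite in_itv/= => /andP[_ tT].
  by apply: subset_itvl; rewrite bnd_simp.
have mF't : measurable_fun `[0, t] (fun s => F' s (x s) i 0).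
  exact: measurable_funS (mF' i).
move/measurable_EFinP in mF't.
have aeE : ae_eq mu `[0, t]%classic (fun s => (F s (x s) i 0)%:E)
    (fun s => (F' s (x s) i 0)%:E).
  exists (P `&` `[0, T]); split => //; first exact: measurableI.
  move=> s /= /not_implyP[sI ne]; split; last exact: sub.
  by apply: hP => /= E; apply: ne; rewrite E.
have mF := measurable_int _ iF.
split; last by congr fine; exact: ae_eq_integral.
apply/integrableP; split => //.
move/integrableP : iF => [_]; congr (_ < _)%E; apply: ae_eq_integral => //.
- exact: measurableT_comp.
- exact: measurableT_comp.
- exact: ae_eq_abse.
Qed.

Lemma measurable_rhs (T L : R) (f : V -> V) (w x : R -> V) i :
  lip L f -> {within `[0, T], continuous x} ->
  measurable_fun setT (fun s => w s i 0) ->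
  measurable_fun `[0, T] (fun s => (f (x s) + w s) i 0).
Proof.
move=> fL cx mw; rewrite [X in measurable_fun _ X](_ : _ =
    (fun s => f (x s) i 0 + w s i 0)); last by apply/funext => s; rewrite mxE.
apply: measurable_funD.
  apply: subspace_continuous_measurable_fun => //.
  move=> s.
  apply: (@continuous_comp (subspace `[0, T]) V R x (fun y => f y i 0) s).
    exact: cx.
  apply: (@continuous_lip _ _ _ _ L) => y z; apply: le_trans (fL z y).
  by have := cV_entry_le (f z - f y) i; rewrite !mxE.
exact: measurable_funTS.
Qed.

Lemma measurable_mulmx_ceval (M : nat) (T : R) (A : 'M[R]_(N, M))
  (u : control T M) i : measurable_fun setT (fun s => (A *m ceval u s) i 0).
Proof.
rewrite [X in measurable_fun _ X](_ : _ =
    (fun s => \sum_j A i j * (u j : R -> R) s)); last first.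
  by apply/funext => s; rewrite !mxE; apply: eq_bigr => j _; rewrite mxE.
apply: measurable_sum => j; apply: measurable_funM; first exact: measurable_cst.
exact: (measurable_funPT (repr (LebesgueSpace.sort (u j)))).
Qed.

End caratheodory.

(** * Step controls as elements of L^2 *)

Lemma exists_Lspace2 {R : realType} (T : R) (h : R -> R) (K : R) :
  measurable_fun setT h -> (forall s, `|h s| <= K) ->
  exists u : LspaceType2 (leb0T T),
    {ae leb0T T, forall s, (u : R -> R) s = h s}.
Proof.
move=> mh hK.
pose hm : {mfun measurableTypeR R >-> measurableTypeR R} :=
  @mfun_Sub _ _ (measurableTypeR R) (measurableTypeR R) h (mem_set mh).
pose q : {mfun_ leb0T T, measurableTypeR R >-> measurableTypeR R} :=
  \pi_{mfun_ leb0T T, measurableTypeR R >-> measurableTypeR R}%qT hm.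
(* The representative chosen in the class of [h] agrees with [h] only almost everywhere. *)
have qE : {ae leb0T T, forall s, (q : R -> R) s = h s}.
  have : (repr q = hm
      %[mod {mfun_ leb0T T, measurableTypeR R >-> measurableTypeR R}])%qT.
    by rewrite reprK.
  by move=> /eqmodP/asboolP; apply: filterS => s /(_ I).
(* The integral of the square is at most K^2 times the length of [0, T]. *)
have fq : finite_norm (leb0T T) 2 (q : R -> R).
  rewrite /finite_norm; apply: (@lty_poweRy _ _ 2) => //.
  rewrite poweR_Lnorm//.
  have mq : measurable_fun setT (q : R -> R).
    exact: (measurable_funPT (repr q)).
  apply: (@le_lt_trans _ _ (\int[leb0T T]_s ((K `^ 2)%R%:E))%E).
    apply: ae_ge0_le_integral => //.
    - by move=> s _; exact: poweR_ge0.
    - apply: (measurableT_comp (measurable_poweR _)) => //.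
      by apply: measurableT_comp => //; exact/measurable_EFinP.
    - by move=> s _; rewrite lee_fin powR_ge0.
    - case: qE => P [mP P0 hP]; exists P; split => // s ns; apply: hP => /= qs.
      apply: ns => _; rewrite /= qs lee_fin.
      by rewrite ge0_ler_powR ?nnegrE// (le_trans (normr_ge0 _) (hK s)).
  rewrite integral_cst// lte_mul_pinfty// ?lee_fin ?powR_ge0//.
  rewrite -[ltLHS]/(mu ([set: R] `&` `[0, T])) setTI.
  by rewrite lebesgue_measure_itv/=; case: ifP => _; rewrite ltry.
exists (LebesgueSpace.Pack (LebesgueSpace.Class
  (isFinLebesgue.Build _ _ _ _ _ (lee1n 2) q fq))).
exact: qE.
Qed.

Lemma exists_control {R : realType} {M : nat} (T c : R) (v : 'cV[R]_M) :
  0 <= c -> c <= T ->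
  exists u : control T M,
    {ae leb0T T, forall s, ceval u s = if c < s then v else 0} /\
    L2norm u = norm2 v * Num.sqrt (T - c).
Proof.
move=> c0 cT.
have /choice[u hu] (i : 'I_M) : exists ui : LspaceType2 (leb0T T),
    {ae leb0T T, forall s, (ui : R -> R) s = if c < s then v i 0 else 0}.
  apply: (@exists_Lspace2 _ _ _ `|v i 0|) => [|s].
    apply: measurable_fun_ifT => //.
    apply: measurable_fun_ltr => //.
  by case: ifP; rewrite ?normr0.
have uE : {ae leb0T T, forall s,
    ceval (u : control T M) s = if c < s then v else 0}.
  apply: ae_leb0T (@filter_forall _ _ _ _ (ae_filter_ringOfSetsType _) hu) _.
  by move=> s _ us; apply/colP => i; rewrite mxE us; case: ifP; rewrite ?mxE.
exists u; split => //.
have E s : norm2 (ceval u s) ^+ 2 = \sum_i (u i : R -> R) s ^+ 2.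
  rewrite sqr_sqrtr; last by rewrite sumr_ge0// => ? _; exact: sqr_ge0.
  by apply: eq_bigr => i _; rewrite mxE.
(* Almost everywhere the integrand is |v|^2 on ]c, T] and 0 before, so the integral is |v|^2 (T -
   c). *)
have iE : (\int[leb0T T]_s (norm2 (ceval u s) ^+ 2)%:E =
    \int[leb0T T]_s ((norm2 v ^+ 2)%:E * (\1_(`]c, T]) s)%:E))%E.
  apply: ae_eq_integral => //.
  - apply/measurable_EFinP; under eq_fun do rewrite E.
    apply: measurable_sum => i; apply: measurable_funX.
    exact: (measurable_funPT (repr (LebesgueSpace.sort (u i)))).
  - apply: emeasurable_funM => //; exact/measurable_EFinP.
  - apply: ae_leb0T uE _ => s; rewrite in_itv/= => /andP[s0 sT] -> _.
    rewrite indicE mem_setE in_itv/= sT andbT; case: ifP => _; rewrite ?mule1//.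
    rewrite mule0 /norm2 big1 ?sqrtr0 ?expr0n// => i _.
    by rewrite mxE expr0n.
have mcT : leb0T T `]c, T] = (T - c)%:E.
  rewrite /leb0T /mrestr setIidl; last by apply: subset_itvr; rewrite bnd_simp.
  rewrite lebesgue_measure_itv/= lte_fin.
  by move: cT; rewrite le_eqVlt => /predU1P[->|->//]; rewrite ltxx subrr.
rewrite /L2norm /Rintegral iE ge0_integralZl_EFin//=; last 2 first.
- exact/measurable_EFinP.
- exact: sqr_ge0.
rewrite integral_indic// setIT [X in (_ * X)%E]mcT -EFinM /=.
by rewrite sqrtrM ?sqr_ge0// sqrtr_sqr ger0_norm ?sqrtr_ge0.
Qed.

(** * Response of the nonlinear and linearized systems to a step control *)

Section response.
Context {R : realType} {N M : nat}.
Local Notation V := 'cV[R]_N.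

(** [solution] is meaningful only once some solution exists: the Picard solution for the step
    forcing also solves the system given by [F], and the solution then selected is carried back to
    the step forcing. The form of [F] is prescribed on [0, T] only, because [state0] is known only
    there. *)
Lemma solution_of_control (T c L : R) (f : V -> V) (F : R -> V -> V)
    (B : 'M[R]_(N, M)) (u : control T M) (v : 'cV[R]_M) :
  0 <= L -> lip L f -> f 0 = 0 -> 0 <= c -> c <= T -> L * (T - c) <= 2^-1 ->
  {ae leb0T T, forall s, ceval u s = if c < s then v else 0} ->
  (forall s, s \in `[0, T] -> F s = fun z => f z + B *m ceval u s) ->
  is_solution T (fun s z => f z + if c < s then B *m v else 0) (solution T F).
Proof.
move=> L0 fL f0 c0 cT Lc uE FE.
pose F1 s z := f z + B *m ceval u s.
pose F2 s z := f z + if c < s then B *m v else 0.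
have F12 : {ae leb0T T, forall s, F1 s = F2 s}.
  apply: ae_leb0T uE _ => s _ us; apply/funext => z; rewrite /F1 /F2 us.
  by case: ifP; rewrite ?mulmx0.
have F1F s : s \in `[0, T] -> F1 s = F s by move=> /FE ->.
have [y sy] := solution_exists f L (B *m v) c T L0 fL f0 cT Lc c0.
have sF : is_solution T F y.
  apply: (is_solution_ae _ _ _ _ _ _ sy).
    by apply: ae_leb0T F12 _ => s sI E; rewrite -F1F// E.
  move=> i; apply: (eq_measurable_fun (fun s => F1 s (y s) i 0)).
    by move=> s; rewrite inE => sI; rewrite F1F.
  by apply: measurable_rhs fL sy.1 _; exact: measurable_mulmx_ceval.
have sG : is_solution T F (solution T F) by apply: getPex; exists y.
apply: (is_solution_ae _ _ _ _ _ _ sG).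
  by apply: ae_leb0T F12 _ => s sI E; rewrite -F1F// E.
move=> i; apply: measurable_rhs fL sG.1 _.
rewrite [X in measurable_fun _ X](_ : _ =
    (fun s => if c < s then (B *m v) i 0 else 0)); last first.
  by apply/funext => s; case: ifP; rewrite ?mxE.
apply: measurable_fun_ifT => //.
exact: measurable_fun_ltr.
Qed.

(** The drift is common, so the right-hand sides differ, apart from [f], by 0 up to [c] and by (B1 -
    B2) v afterwards. Leaving [f] general covers both the nonlinear and the linearized system. *)
Lemma solution_neq (T c L : R) (f : V -> V) (F1 F2 : R -> V -> V)
    (B1 B2 : 'M[R]_(N, M)) (u : control T M) (v : 'cV[R]_M) :
  0 <= L -> lip L f -> f 0 = 0 -> 0 <= c -> c < T -> L * (T - c) <= 4^-1 ->
  {ae leb0T T, forall s, ceval u s = if c < s then v else 0} ->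
  (forall s, s \in `[0, T] -> F1 s = fun z => f z + B1 *m ceval u s) ->
  (forall s, s \in `[0, T] -> F2 s = fun z => f z + B2 *m ceval u s) ->
  (B1 - B2) *m v != 0 -> solution T F1 T != solution T F2 T.
Proof.
move=> L0 fL f0 c0 cT Lc uE F1E F2E w0.
have Lc2 : L * (T - c) <= 2^-1 by apply: le_trans Lc _; lra.
have s1 := solution_of_control _ _ _ _ _ _ _ _ L0 fL f0 c0 (ltW cT) Lc2 uE F1E.
have s2 := solution_of_control _ _ _ _ _ _ _ _ L0 fL f0 c0 (ltW cT) Lc2 uE F2E.
apply: (@solution_gap R N T _ _ _ _ c _ L s1 s2) w0 _ _ => // s.
  by rewrite in_itv/= => /andP[_ sc]; rewrite ltNge sc/= !addr0.
rewrite in_itv/= => /andP[cs _]; rewrite cs mulmxBl.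
by rewrite (opprD (f _)) addrACA addrK.
Qed.

(** Zero solves the unforced equation because g 0 = 0, and uniqueness identifies the selected
    solution with it. *)
Lemma state0_eq0 (T L : R) (g : V -> V) : 0 <= L -> lip L g -> g 0 = 0 ->
  0 <= T -> forall t, t \in `[0, T] -> state0 g T t = 0.
Proof.
move=> L0 gL g0 T0.
have s0 : is_solution T (fun=> g) (fun=> 0).
  split; first by apply: continuous_subspaceT => ?; exact: cvg_cst.
  move=> t tI i; rewrite g0 mxE; split; first exact: integrable0.
  by rewrite /Rintegral integral0.
have sg : is_solution T (fun=> g) (state0 g T).
  by apply: getPex; exists (fun=> 0).
exact: (solution_unique T _ _ _ _ T L sg s0).
Qed.

(** As [state0] vanishes, the Jacobian is frozen at 0 and the linearized drift is the constant
    linear map [jac g 0]. *)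
Lemma lin_state_neq (T c L : R) (g : V -> V) (B1 B2 : 'M[R]_(N, M))
    (u : control T M) (v : 'cV[R]_M) :
  0 <= L -> lip L g -> lip L (mulmx (jac g 0) : V -> V) -> g 0 = 0 ->
  0 <= c -> c < T -> L * (T - c) <= 4^-1 ->
  {ae leb0T T, forall s, ceval u s = if c < s then v else 0} ->
  (B1 - B2) *m v != 0 -> lin_state g B1 u T != lin_state g B2 u T.
Proof.
move=> L0 gL JL g0 c0 cT Lc uE w0.
have FE (B : 'M[R]_(N, M)) s : s \in `[0, T] ->
    (fun z : V => jac g (state0 g T s) *m z + B *m ceval u s) =
    (fun z : V => jac g 0 *m z + B *m ceval u s).
  by move=> sI; rewrite (state0_eq0 T L g L0 gL g0 (le_trans c0 (ltW cT)) s sI).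
have J0 : jac g 0 *m (0 : V) = 0 by rewrite mulmx0.
exact: (solution_neq T c L (mulmx (jac g 0)) _ _ B1 B2 u v L0 JL J0 c0 cT Lc uE
  (FE B1) (FE B2) w0).
Qed.

End response.

(** * Linear independence and choice of the control *)

Lemma Apart_neq {R : realType} {N M K : nat} (A : K.-tuple 'M[R]_(N, M))
  (k : 'I_K) (beta : 'cV[R]_k) : free A -> Apart A beta != tnth A k.
Proof.
move=> fA; apply/eqP => E.
(* The first k + 1 matrices are independent and [tnth A k] is the last of them; equality would put
   it in the span of the others. *)
have : free (take k.+1 A).
  by move: fA; rewrite -{1}(cat_take_drop k.+1 A); exact: catl_free.
rewrite (take_nth 0) ?size_tuple// -tnth_nth.
rewrite (perm_free (_ : perm_eq _ (tnth A k :: take k A))); last first.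
  by rewrite perm_rcons.
rewrite free_cons => /andP[/negP + _]; apply; rewrite -E.
apply: rpred_sum => j _; apply: rpredZ; apply: memv_span.
rewrite (tnth_nth 0)/= -(nth_take 0 (ltn_ord j)) mem_nth//.
by rewrite size_take size_tuple ltn_ord.
Qed.

(** The witness is a basis vector, whose image is a nonzero column of [B]. *)
Lemma exists_mulmx_neq0 {R : realType} {m n : nat} (B : 'M[R]_(m, n)) :
  B != 0 -> exists v : 'cV[R]_n, B *m v != 0.
Proof.
move=> B0; apply: contrapT => h; move/eqP : B0; apply.
apply/matrixP => i j; have : B *m delta_mx j (0 : 'I_1) = 0.
  by apply: contrapT => /eqP hj; apply: h; exists (delta_mx j 0).
by rewrite -colE => /matrixP/(_ i 0); rewrite !mxE.
Qed.

Theorem theorem7p13 (R : realType) (N M K : nat)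
    (hN : (0 < N)%N) (hM : (0 < M)%N) (hK : (0 < K)%N)
    (T : R) (hT : 0 < T)
    (Ead : set (control T M)) (hEad0 : Ead !=set0)
    (hEadc : weakly_compact Ead) (hEadi : zero_interior Ead)
    (A : K.-tuple 'M[R]_(N, M)) (hA : free A)
    (g : 'cV[R]_N -> 'cV[R]_N) (L : R)
    (hg1 : class_C1 g) (hgL : lipschitz2 L g) (hg0 : g 0 = 0)
    (alpha0 : 'cV[R]_K) (halpha0 : alpha0 = 0)
    (C : 'M[R]_N) (hC : C = 1%:M)
    (Kset : forall j : 'I_K, set 'cV[R]_j)
    (hKset : forall j : 'I_K, (0 < j)%N -> compact (Kset j))
    (eps : 'I_K -> control T M) (beta : forall j : 'I_K, 'cV[R]_j)
    (k : 'I_K)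
    (hk : (k = 0%N :> nat /\ beta k = 0) \/
          ((0 < k)%N /\ GR_until_fitting A C g Ead alpha0 Kset eps beta k)) :
  [set u | [/\ Ead u,
     0 < state_gap C g (Acomb A alpha0 + Apart A (beta k))
                       (Acomb A alpha0 + tnth A k) u
   & 0 < lin_state_gap C g (Apart A (beta k)) (tnth A k) u]] !=set0.
Proof.
have Acomb0 : Acomb A alpha0 = 0.
  by rewrite halpha0 /Acomb big1// => j _; rewrite mxE scale0r.
rewrite Acomb0 !add0r hC.
have [v w0] : exists v : 'cV[R]_M, (Apart A (beta k) - tnth A k) *m v != 0.
  by apply: exists_mulmx_neq0; rewrite subr_eq0; exact: Apart_neq.
set B1 := Apart A (beta k) in w0 *; set B2 := tnth A k in w0 *.
case: hEadi => r r0 hr.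
pose J := jac g 0; pose LJ := \sum_i \sum_j `|J i j|; pose Lg := `|L| * N%:R.
have LJ0 : 0 <= LJ by apply: sumr_ge0 => i _; exact: sumr_ge0.
have Lg0 : 0 <= Lg by rewrite mulr_ge0.
have gL := lip_lipschitz2 _ _ hgL; rewrite -/Lg in gL.
have JL := lip_mulmx J; rewrite -/LJ in JL.
(* A common Lipschitz constant for [g] and its derivative at 0, so that one control separates both
   pairs of states. *)
pose L' := Lg + LJ.
have L'0 : 0 <= L' by rewrite addr_ge0.
have gL' : lip L' g by apply: lip_le gL; rewrite lerDl.
have JL' : lip L' (mulmx J : 'cV_N -> 'cV_N) by apply: lip_le JL; rewrite lerDr.
have v1 : 0 < norm2 v + 1 by rewrite ltr_wpDl// sqrtr_ge0.
pose e := r / (norm2 v + 1).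
have e0 : 0 < e by rewrite divr_gt0.
(* The three bounds keep the switching time T - d nonnegative, give L' d <= 1/4, and give |v| sqrt d
   <= |v| e < r in the Euclidean norm of [v], which places the control in [Ead]. *)
pose d := Num.min T (Num.min (4 * (L' + 1))^-1 (e ^+ 2)).
have L'1 : 0 < L' + 1 by rewrite ltr_wpDl.
have d0 : 0 < d by rewrite !lt_min hT invr_gt0 mulr_gt0//= exprn_gt0.
have dT : d <= T by rewrite ge_min lexx.
have dL : L' * d <= 4^-1.
  apply: (@le_trans _ _ (L' * (4 * (L' + 1))^-1)).
    by rewrite ler_wpM2l// !ge_min lexx orbT.
  rewrite invfM mulrCA ler_piMr ?invr_ge0//.
  by rewrite ler_pdivrMr// mul1r lerDl.
have de : Num.sqrt d <= e.
  rewrite -(ger0_norm (ltW e0)) -sqrtr_sqr ler_wsqrtr//.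
  by rewrite !ge_min lexx !orbT.
have c0 : 0 <= T - d by rewrite subr_ge0.
have cT : T - d < T by rewrite ltrBlDr ltrDl.
have Tc : T - (T - d) = d by rewrite subKr.
have [u [uE un]] := exists_control T (T - d) v c0 (ltW cT).
rewrite Tc in un.
have dL' : L' * (T - (T - d)) <= 4^-1 by rewrite Tc.
exists u; split.
- apply: hr; rewrite un.
  apply: (@le_lt_trans _ _ (norm2 v * e)).
    by rewrite ler_wpM2l// sqrtr_ge0.
  by rewrite mulrA ltr_pdivrMr// mulrC ltr_pM2l// ltrDl.
- rewrite /state_gap !mul1mx exprn_gt0// norm2_gt0// subr_eq0.
  exact: (solution_neq T (T - d) L' g _ _ B1 B2 u v).
- rewrite /lin_state_gap !mul1mx exprn_gt0// norm2_gt0// subr_eq0.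
  exact: (lin_state_neq T (T - d) L' g B1 B2 u v).
Qed.
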